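(* Let $g(q)\in\mathbb Z[q]$. There exists a functor $\overline{\mathsf B}^{g(q)}$ from the category $\mathbb Z[q]\otimes\Psi$-Rings to the category of (not necessarily unital) commutative rings such that: (1) for every object $R$, the underlying set of $\overline{\mathsf B}^{g(q)}(R)$ is $R^{\mathbb N}$; (2) for every morphism $f:R\to S$ and every $\alpha\in\overline{\mathsf B}^{g(q)}(R)$, $\overline{\mathsf B}^{g(q)}(f)(\alpha)=f\circ\alpha$; (3) for every object $R$, the map $$\overline\varphi^{g(q)}_R:\overline{\mathsf B}^{g(q)}(R)\to\mathrm{gh}(R),\qquad (a_n)_{n\in\mathbb N}\mapsto\Big(\sum_{d|n}d\big(1-g(q)^{n/d}\big)\Psi^{n/d}(a_d)\Big)_{n\in\mathbb N}$$ is a ring homomorphism. If $g(q)\neq1$, then $\overline{\mathsf B}^{g(q)}$ is uniquely determined by (1)–(3).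
   Context: A $\Psi$-ring is a commutative ring $R$ with unity together with maps $\Psi^n:R\to R$ ($n\ge1$) such that $\Psi^1=\mathrm{id}$, each $\Psi^n$ is additive, multiplicative and satisfies $\Psi^n(1)=1$, and $\Psi^n\circ\Psi^m=\Psi^{nm}$. The category $\mathbb Z[q]\otimes\Psi$-Rings has as objects $\mathbb Z[q]$-algebras (commutative, unital) equipped with a $\Psi$-ring structure such that $\Psi^n(q)=q^n$ for all $n\ge1$, and as morphisms the unity-preserving $\mathbb Z[q]$-algebra homomorphisms commuting with all $\Psi^n$. $\mathrm{gh}(R)$ is the ring $R^{\mathbb N}$ with componentwise operations. *)

(* Defs.v *)
From HB Require Import structures.
From mathcomp Require Import all_boot all_order all_algebra.
Set Implicit Arguments. Unset Strict Implicit. Unset Printing Implicit Defensive.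
Import Order.TTheory GRing.Theory Num.Theory.
Local Open Scope ring_scope.

(* A Z[q] (x) Psi-ring: a commutative unital ring R (possibly the zero ring),
   a Z[q]-algebra structure (= the image q of the variable), and Adams
   operations Psi^n, n >= 1 (the value Psi 0 is irrelevant). *)
Definition is_zqPsi (R : comPzRingType) (q : R) (Psi : nat -> R -> R) : Prop :=
  ((forall x, Psi 1%N x = x) /\
      (forall n, (0 < n)%N -> forall x y, Psi n (x + y) = Psi n x + Psi n y) /\
      (forall n, (0 < n)%N -> forall x y, Psi n (x * y) = Psi n x * Psi n y) /\
      (forall n, (0 < n)%N -> Psi n 1 = 1) /\
      (forall n m, (0 < n)%N -> (0 < m)%N -> forall x,
          Psi n (Psi m x) = Psi (n * m)%N x) /\
      (forall n, (0 < n)%N -> Psi n q = q ^+ n)).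

Record PsiObj := {
  pcar :> comPzRingType;
  pq : pcar;
  pPsi : nat -> pcar -> pcar;
  pax : is_zqPsi pq pPsi }.

Definition is_PsiMor (R S : PsiObj) (f : R -> S) : Prop :=
  [/\ (forall x y, f (x + y) = f x + f y),
      (forall x y, f (x * y) = f x * f y),
      f 1 = 1,
      f (@pq R) = @pq S
    & (forall n, (0 < n)%N -> forall x, f (@pPsi R n x) = @pPsi S n (f x))].

Definition evalq (g : {poly int}) (R : PsiObj) : R :=
  \sum_(i < size g) (g`_i)%:~R * @pq R ^+ i.

(* Sequences indexed by N = {1,2,...}: a : nat -> R with (a k) = a_{k+1}. *)
Definition seqN (R : Type) := nat -> R.

Record rngOps (T : Type) := RngOps {
  radd : T -> T -> T; rzero : T; ropp : T -> T; rmul : T -> T -> T }.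

Definition is_comRng (T : Type) (o : rngOps T) : Prop :=
  ((forall x y z, radd o x (radd o y z) = radd o (radd o x y) z) /\
      (forall x y, radd o x y = radd o y x) /\
      (forall x, radd o (rzero o) x = x) /\
      (forall x, radd o (ropp o x) x = rzero o) /\
      (forall x y z, rmul o x (rmul o y z) = rmul o (rmul o x y) z) /\
      (forall x y, rmul o x y = rmul o y x) /\
      (forall x y z, rmul o (radd o x y) z = radd o (rmul o x z) (rmul o y z))).

Definition is_rngHom (T U : Type) (oT : rngOps T) (oU : rngOps U) (h : T -> U) :=
  (forall x y, h (radd oT x y) = radd oU (h x) (h y)) /\
  (forall x y, h (rmul oT x y) = rmul oU (h x) (h y)).

Definition ghOps (R : comPzRingType) : rngOps (seqN R) :=
  @RngOps (seqN R) (fun a b k => a k + b k) (fun _ => 0) (fun a k => - a k)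
          (fun a b k => a k * b k).

Definition ghostmap (g : {poly int}) (R : PsiObj) (a : seqN R) : seqN R :=
  fun k => \sum_(d <- divisors k.+1)
     (d%:R * (1 - evalq g R ^+ (k.+1 %/ d)) * @pPsi R (k.+1 %/ d) (a d.-1)).

(* A functor B from Z[q](x)Psi-Rings to commutative rngs satisfying (1)-(3):
   (1) B(R) has underlying set R^N (the ring structure is given by B R),
   (2) B(f) = f o -, which must be a rng homomorphism (functoriality laws
       then hold automatically),
   (3) the ghost map is a rng homomorphism B(R) -> gh(R). *)
Definition is_Bbar (g : {poly int}) (B : forall R : PsiObj, rngOps (seqN R)) :=
  [/\ (forall R : PsiObj, is_comRng (B R)),
      (forall (R S : PsiObj) (f : R -> S), is_PsiMor f ->
          is_rngHom (B R) (B S) (fun a : seqN R => fun k => f (a k)))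
    & (forall R : PsiObj, is_rngHom (B R) (ghOps R) (@ghostmap g R))].

(* Main.v *)
(* Addition is componentwise, since each Psi^n is additive. For the product,
   let delta_d be the indicator sequence of d over Z[q]. A Dwork-type criterion
   describes the image of the ghost map over Z[q] by (1 - g)-divisibility and
   by congruences modulo p^(v_p n) relating the n-th term to Psi^p of the
   (n/p)-th one, Psi^p being a lift of Frobenius on Z[q]. These conditions are
   stable under products, so delta_d * delta_e exists, with coordinates
   K_n(d, e) in Z[q], and
     (a * b)_n = sum_(d, e | n) K_n(d, e) Psi^(n/d)(a_d) Psi^(n/e)(b_e)
   has the right ghost components over any R.

   Both the ring axioms and uniqueness are then checked on a ring where the
   ghost map is injective: every R is a quotient of the monoid algebra
   Z[q][M], where M is the multiplicative monoid of R with a unit adjoined and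
   Psi^n acts on monomials; it is free over Z[q], so that n (1 - g) is a
   nonzerodivisor as soon as g <> 1. If g = 1 the ghost map vanishes and the
   zero product will do. *)
From HB Require Import structures.
From Stdlib Require Import FunctionalExtensionality.
Require Import Defs.
From mathcomp Require Import all_boot all_order all_algebra finmap zify.
From mathcomp.multinomials Require Import monalg.
Set Implicit Arguments. Unset Strict Implicit.
Unset Printing Implicit Defensive.
Import GRing.Theory Num.Theory.
Local Open Scope ring_scope.

Definition divides (R : comPzRingType) (c x : R) : Prop := exists z, x = c * z.

(** * Divisibility and Frobenius congruences *)

Section Divides.
Variable R : comPzRingType.
Implicit Types c x y : R.

Lemma divides_refl c : divides c c.
Proof. by exists 1; rewrite mulr1. Qed.

Lemma divides0 c : divides c 0.
Proof. by exists 0; rewrite mulr0. Qed.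

Lemma dividesD c x y : divides c x -> divides c y -> divides c (x + y).
Proof. by move=> [z ->] [t ->]; exists (z + t); rewrite mulrDr. Qed.

Lemma dividesN c x : divides c x -> divides c (- x).
Proof. by move=> [z ->]; exists (- z); rewrite mulrN. Qed.

Lemma dividesB c x y : divides c x -> divides c y -> divides c (x - y).
Proof. by move=> hx hy; apply/dividesD/dividesN. Qed.

Lemma divides_mulr c x y : divides c x -> divides c (x * y).
Proof. by move=> [z ->]; exists (z * y); rewrite mulrA. Qed.

Lemma divides_mull c x y : divides c y -> divides c (x * y).
Proof. by rewrite mulrC; apply: divides_mulr. Qed.

Lemma divides_mul c d x y :
  divides c x -> divides d y -> divides (c * d) (x * y).
Proof. by move=> [z ->] [t ->]; exists (z * t); rewrite mulrACA. Qed.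

Lemma divides_sum (I : Type) (r : seq I) (P : pred I) (F : I -> R) c :
  (forall i, P i -> divides c (F i)) -> divides c (\sum_(i <- r | P i) F i).
Proof.
by move=> h; apply: big_rec => [|i x Pi]; [apply: divides0 | apply/dividesD/h].
Qed.

Lemma divides_sum_seq (I : eqType) (r : seq I) (F : I -> R) c :
  (forall i, i \in r -> divides c (F i)) -> divides c (\sum_(i <- r) F i).
Proof. by move=> h; rewrite big_seq; apply: divides_sum. Qed.

Lemma divides_nat m n : (m %| n)%N -> divides (m%:R : R) n%:R.
Proof. by case/dvdnP=> k ->; exists k%:R; rewrite -natrM mulnC. Qed.

Lemma dividesBM c x x' y y' :
  divides c (x - x') -> divides c (y - y') -> divides c (x * y - x' * y').
Proof.
move=> hx hy.
have -> : x * y - x' * y' = (x - x') * y + x' * (y - y').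
  by rewrite mulrBl mulrBr addrA subrK.
by apply: dividesD; [apply: divides_mulr | apply: divides_mull].
Qed.

Lemma divides_subX c x y n : divides c (x - y) -> divides c (x ^+ n - y ^+ n).
Proof. by move=> h; rewrite subrXX; apply: divides_mulr. Qed.

Lemma prime_frobeniusD p x y : prime p ->
  divides (p%:R : R) ((x + y) ^+ p - (x ^+ p + y ^+ p)).
Proof.
move=> pp; case: p pp => // p pp.
rewrite exprDn big_ord_recr big_ord_recl /= subn0 subnn bin0 binn !mulr1n.
rewrite expr0 mulr1 mul1r addrAC [X in divides _ X]addrC addKr.
apply: divides_sum => i _; rewrite -[X in divides _ X]mulr_natl.
apply/divides_mulr/divides_nat/prime_dvd_bin => //=.
by rewrite /bump /= add1n ltnS ltn_ord.
Qed.

(** Modulo [p] each of the [p] terms is congruent to [x ^+ p.-1], so the sum is congruent to [p]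
    equal terms. *)
Lemma divides_sumX_prime p x y : divides (p%:R : R) (x - y) ->
  divides (p%:R : R) (\sum_(i < p) x ^+ (p.-1 - i) * y ^+ i).
Proof.
move=> xy.
have -> : \sum_(i < p) x ^+ (p.-1 - i) * y ^+ i =
    \sum_(i < p) (x ^+ (p.-1 - i) * y ^+ i - x ^+ (p.-1 - i) * x ^+ i)
    + \sum_(i < p) x ^+ p.-1.
  rewrite -big_split /=; apply: eq_bigr => i _.
  have ip : (i <= p.-1)%N.
    by rewrite -ltnS prednK // (leq_ltn_trans _ (ltn_ord i)).
  by rewrite -exprD subnK // subrK.
apply: dividesD; last first.
  rewrite sumr_const card_ord -[X in divides _ X]mulr_natl.
  exact/divides_mulr/divides_refl.
apply: divides_sum => i _; rewrite -mulrBr; apply: divides_mull.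
by apply: divides_subX; rewrite -opprB; apply: dividesN.
Qed.

(* Each p-th power raises the p-adic precision of a congruence by one. *)
Lemma divides_subX_logn p x y n : prime p -> (0 < n)%N ->
  divides (p%:R : R) (x - y) ->
  divides ((p ^ (logn p n).+1)%:R : R) (x ^+ n - y ^+ n).
Proof.
move=> pp n_gt0 xy.
have pow s : divides ((p ^ s.+1)%:R : R) (x ^+ (p ^ s) - y ^+ (p ^ s)).
  elim: s => [|s IHs]; first by rewrite expn0 !expr1 expn1.
  rewrite [(p ^ s.+1)%N]expnSr !exprM subrXX.
  rewrite [(p ^ s.+2)%N]expnSr natrM; apply: divides_mul => //.
  by apply: divides_sumX_prime; apply: divides_subX.
(* Split [n] into its [p]-part and a cofactor; raising to the cofactor preserves the divisibility
   already obtained. *)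
rewrite {2 3}(divn_eq n (p ^ logn p n)) (eqP (pfactor_dvdnn p n)) addn0 mulnC.
by rewrite !exprM; apply: divides_subX.
Qed.

Lemma sub1X x n : 1 - x ^+ n = (1 - x) * \sum_(i < n) x ^+ i.
Proof. by rewrite -opprB subrX1 -mulNr opprB. Qed.

(** Each [p]-th power contributes a geometric sum divisible by [p], on top of the factor [1 - x],
    which is kept whole. This gives the third condition of [dwork]. *)
Lemma divides_sub1X_logn p x n : prime p -> (0 < n)%N ->
  divides (p%:R : R) (1 - x) ->
  divides ((p ^ logn p n)%:R * (1 - x)) (1 - x ^+ n).
Proof.
move=> pp n_gt0 hx.
have pow s : divides ((p ^ s)%:R * (1 - x)) (1 - x ^+ (p ^ s)).
  elim: s => [|s IHs]; first by rewrite mul1r expr1; apply: divides_refl.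
  rewrite [(p ^ s.+1)%N]expnSr exprM (sub1X _ p) natrM mulrAC.
  apply: divides_mul => //.
  have := @divides_sumX_prime p 1 (x ^+ (p ^ s)).
  under eq_bigr do rewrite expr1n mul1r.
  by apply; have := divides_subX (p ^ s) hx; rewrite expr1n.
rewrite {2}(divn_eq n (p ^ logn p n)) (eqP (pfactor_dvdnn p n)) addn0 mulnC.
by rewrite exprM (sub1X _ (n %/ _)%N); apply: divides_mulr.
Qed.

End Divides.

(** * Frobenius lifts and contents in Z[q] *)

Section IntPoly.
Implicit Types f g h : {poly int}.

Lemma comp_polyXnX f m n :
  (f \Po 'X^m) \Po 'X^n = f \Po 'X^(n * m).
Proof. by rewrite -comp_polyA comp_Xn_poly exprM. Qed.

Lemma frobenius_int p (c : int) : prime p -> (p%:Z %| c ^+ p - c)%Z.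
Proof.
move=> pp; have chp := pchar_Fp pp.
rewrite (dvdz_pcharf chp) rmorphB rmorphXn /= subr_eq0; apply/eqP.
by rewrite -[LHS]/(pFrobenius_aut chp _) rmorph_int.
Qed.

(** Horner induction: the [p]-th power is additive modulo [p], and Fermat's little theorem handles
    the constant term. *)
Lemma frobenius_poly p f : prime p ->
  divides (p%:R : {poly int}) (f \Po 'X^p - f ^+ p).
Proof.
move=> pp; elim/poly_ind: f => [|f c IHf].
  by rewrite comp_poly0 expr0n eqn0Ngt prime_gt0 // subr0; apply: divides0.
rewrite comp_poly_MXaddC.
have /dividesN := prime_frobeniusD (f * 'X) c%:P pp; rewrite opprB => hD.
have hX : divides (p%:R : {poly int}) ((f \Po 'X^p) * 'X^p - (f * 'X) ^+ p).
  by rewrite exprMn; apply: dividesBM => //; rewrite subrr; apply: divides0.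
have hc : divides (p%:R : {poly int}) (c%:P - c%:P ^+ p).
  have /dvdzP[k hk] := frobenius_int c pp.
  rewrite -opprB; apply: dividesN; exists k%:P.
  by rewrite -polyC_exp -polyCB hk polyCM mulrC -natz polyC_natr.
have := dividesD (dividesD hX hc) hD.
rewrite [X in divides _ (X + _)]addrACA -opprD.
by rewrite [X in divides _ X]addrA subrK.
Qed.

Lemma divides_natP m f :
  divides (m%:R : {poly int}) f <-> (m%:Z %| zcontents f)%Z.
Proof.
split=> [[h ->]|/dvdzP[k hk]].
  by rewrite mulr_natl -scaler_nat natz zcontentsZ dvdz_mulr.
exists (k *: zprimitive f).
by rewrite mulr_natl -scaler_nat natz scalerA mulrC -hk -zpolyEprim.
Qed.

(** Gauss's lemma: contents multiply, and the content of [f] is prime to [p]. *)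
Lemma divides_cancel_prime p s f h : prime p ->
  ~ divides (p%:R : {poly int}) f ->
  divides ((p ^ s)%:R : {poly int}) (f * h) ->
  divides ((p ^ s)%:R : {poly int}) h.
Proof.
move=> pp nf /divides_natP fh; apply/divides_natP.
move: fh; rewrite zcontentsM Gauss_dvdzr //.
rewrite -[coprimez _ _]/(coprime (p ^ s) `|zcontents f|%N).
by rewrite coprimeXl // prime_coprime //; apply/negP => /(divides_natP p f).
Qed.

Lemma divides_nat_partwise n f : (0 < n)%N ->
  (forall p, prime p -> divides ((p ^ logn p n)%:R : {poly int}) f) ->
  divides (n%:R : {poly int}) f.
Proof.
move=> n_gt0 h; apply/divides_natP.
apply/(@dvdn_partP n `|zcontents f|%N) => // p.
rewrite mem_primes => /andP[pp _]; rewrite p_part.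
exact/(divides_natP (p ^ logn p n) f)/h.
Qed.

End IntPoly.

(** * Psi-rings and the ghost map *)

Lemma ring_hom_rmorphism (S T : comPzRingType) (f : S -> T) :
  (forall x y, f (x + y) = f x + f y) ->
  (forall x y, f (x * y) = f x * f y) -> f 1 = 1 ->
  exists h : {rmorphism S -> T}, f = h.
Proof.
move=> fD fM f1.
have f0 : f 0 = 0 by apply: (addIr (f 0)); rewrite -fD !add0r.
pose mA := GRing.isNmodMorphism.Build S T f (conj f0 fD).
pose mM := GRing.isMonoidMorphism.Build S T f (conj f1 fM).
by exists (HB.pack f mA mM : {rmorphism S -> T}).
Qed.

Section PsiRings.
Variable R : PsiObj.

Lemma Psi1E (x : R) : pPsi 1 x = x.
Proof. by case: (pax R). Qed.

Lemma Psi_rmorphism n : (0 < n)%N ->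
  exists h : {rmorphism R -> R}, @pPsi R n = h.
Proof.
by move=> n0; case: (pax R) => _ [D [M [U _]]]; apply: ring_hom_rmorphism; auto.
Qed.

Lemma PsiPsi m n (x : R) : (0 < m)%N -> (0 < n)%N ->
  pPsi m (pPsi n x) = pPsi (m * n) x.
Proof. by case: (pax R) => _ [_ [_ [_ [h _]]]] m0 n0; apply: h. Qed.

Lemma Psi_q n : (0 < n)%N -> pPsi n (@pq R) = @pq R ^+ n.
Proof. by case: (pax R) => _ [_ [_ [_ [_ h]]]]; apply: h. Qed.

End PsiRings.

Lemma PsiMor_rmorphism (R S : PsiObj) (f : R -> S) : is_PsiMor f ->
  exists h : {rmorphism R -> S}, f = h.
Proof. by case=> D M U _ _; apply: ring_hom_rmorphism. Qed.

Lemma PsiMor_evalq g (R S : PsiObj) (f : R -> S) : is_PsiMor f ->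
  f (evalq g R) = evalq g S.
Proof.
move=> fm; case: (fm) => _ _ _ fq _; move: fq.
have [h ->] := PsiMor_rmorphism fm => hq.
rewrite /evalq rmorph_sum; apply: eq_bigr => i _.
by rewrite rmorphM rmorph_int rmorphXn /= hq.
Qed.

(** * The structure map from Z[q] *)

Section EvalQ.
Variable R : PsiObj.

Lemma evalq_widen (p : {poly int}) n : (size p <= n)%N ->
  evalq p R = \sum_(i < n) (p`_i)%:~R * @pq R ^+ i.
Proof.
move=> le; pose F i := (p`_i)%:~R * @pq R ^+ i.
rewrite /evalq (big_ord_widen n F le) big_mkcond.
apply: eq_bigr => i _; case: ltnP => // h.
by rewrite nth_default // mul0r.
Qed.

Lemma evalqD (p r : {poly int}) : evalq (p + r) R = evalq p R + evalq r R.
Proof.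
have le := size_polyD p r.
rewrite (evalq_widen le) (evalq_widen (leq_maxl (size p) (size r))).
rewrite (evalq_widen (leq_maxr (size p) (size r))) -big_split /=.
by apply: eq_bigr => i _; rewrite coefD intrD mulrDl.
Qed.

Lemma evalqC (c : int) : evalq c%:P R = c%:~R.
Proof.
by rewrite (evalq_widen (size_polyC_leq1 c)) big_ord1 coefC expr0 mulr1.
Qed.

Lemma evalqMX (p : {poly int}) : evalq (p * 'X) R = evalq p R * @pq R.
Proof.
have le : (size (p * 'X)%R <= (size p).+1)%N.
  by have [->|/size_mulX ->//] := eqVneq p 0; rewrite mul0r size_poly0.
rewrite (evalq_widen le) big_ord_recl coefMX eqxx mul0r add0r mulr_suml.
by apply: eq_bigr => i _; rewrite coefMX /= exprSr mulrA.
Qed.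

Lemma evalqCM (c : int) (p : {poly int}) :
  evalq (c%:P * p) R = c%:~R * evalq p R.
Proof.
have le : (size (c%:P * p)%R <= size p)%N by rewrite mul_polyC size_scale_leq.
rewrite (evalq_widen le) mulr_sumr; apply: eq_bigr => i _.
by rewrite coefCM intrM mulrA.
Qed.

Lemma evalqM (p r : {poly int}) : evalq (p * r) R = evalq p R * evalq r R.
Proof.
elim/poly_ind: p => [|p c IHp].
  by rewrite mul0r -polyC0 evalqC mul0r.
rewrite mulrDl (mulrAC p) !evalqD evalqCM evalqC !evalqMX IHp mulrDl.
by rewrite (mulrAC (evalq p R)).
Qed.

Lemma evalqX n : evalq 'X^n R = @pq R ^+ n.
Proof.
elim: n => [|n IHn]; first by rewrite !expr0 -[1]/(1%:P) evalqC.
by rewrite !exprSr evalqMX IHn.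
Qed.

Lemma evalq_comp n (p : {poly int}) : (0 < n)%N ->
  evalq (p \Po 'X^n) R = pPsi n (evalq p R).
Proof.
move=> n0; have [h hE] := Psi_rmorphism R n0.
have := Psi_q R n0; rewrite hE => hq.
elim/poly_ind: p => [|p c IHp].
  by rewrite comp_poly0 -polyC0 evalqC rmorph_int.
rewrite comp_poly_MXaddC !evalqD evalqMX !evalqC (evalqM (p \Po 'X^n)) IHp.
by rewrite evalqX rmorphD rmorphM rmorph_int hq.
Qed.

End EvalQ.

Lemma ZQ_subproof :
  @is_zqPsi {poly int} 'X (fun n (f : {poly int}) => f \Po 'X^n).
Proof.
split; first by move=> f; rewrite expr1 comp_polyXr.
split; first by move=> n _ f h; rewrite comp_polyD.
split; first by move=> n _ f h; rewrite comp_polyM.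
split; first by move=> n _; rewrite comp_polyC.
split; first by move=> n m _ _ f; rewrite comp_polyXnX.
by move=> n _; rewrite comp_polyX.
Qed.

(** [evalq_PsiMor] maps this object to every [R], so identities proved over Z[q] transfer to all
    Psi-rings. *)
Definition ZQ : PsiObj := Build_PsiObj ZQ_subproof.

Lemma evalq_ZQ (f : {poly int}) : evalq f ZQ = f.
Proof.
rewrite -[RHS]coefK poly_def; apply: eq_bigr => i _.
by rewrite -mul_polyC -[in RHS](intz f`_i) rmorph_int.
Qed.

Lemma evalq_PsiMor (R : PsiObj) : is_PsiMor (fun f : ZQ => evalq f R).
Proof.
split; [exact: evalqD | exact: evalqM | | | ].
- by rewrite -[1 : ZQ]/(1%:P : {poly int}) evalqC.
- by rewrite -[@pq ZQ]/('X^1 : {poly int}) evalqX.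
- by move=> n n0 f; apply: evalq_comp.
Qed.

(** * Ghost components: recursion, naturality, injectivity *)

Lemma big_divisors_dvd (V : nmodType) (F : nat -> V) m n :
  (0 < n)%N -> (m %| n)%N ->
  \sum_(d <- divisors n | (d %| m)%N) F d = \sum_(d <- divisors m) F d.
Proof.
move=> n0 mn; have m0 := dvdn_gt0 n0 mn.
rewrite -big_filter; apply: perm_big; apply: uniq_perm.
- exact/filter_uniq/divisors_uniq.
- exact: divisors_uniq.
move=> d; rewrite mem_filter -!dvdn_divisors //.
by case dm: (d %| m)%N => //=; apply: dvdn_trans mn.
Qed.

Lemma divn_dvd_gt0 n d : (0 < n)%N -> (d %| n)%N -> (0 < n %/ d)%N.
Proof. by move=> n0 dn; rewrite divn_gt0 ?(dvdn_gt0 n0 dn) // dvdn_leq. Qed.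

(* Sequences are indexed here by n itself, the value at 0 being irrelevant. *)
Definition ghost (g : {poly int}) (R : PsiObj) (a : nat -> R) (n : nat) : R :=
  \sum_(d <- divisors n)
     (d%:R * (1 - evalq g R ^+ (n %/ d)) * pPsi (n %/ d) (a d)).

Section Ghost.
Variable g : {poly int}.

Lemma eq_ghost (R : PsiObj) (a b : nat -> R) n : (0 < n)%N ->
  (forall d, (d %| n)%N -> a d = b d) -> ghost g a n = ghost g b n.
Proof.
move=> n0 ab; rewrite /ghost !big_seq; apply: eq_bigr => d.
by rewrite -dvdn_divisors // => /ab ->.
Qed.

(** The ghost map is triangular for divisibility: the coordinate [a n] enters only through the term
    [d = n], with coefficient [n (1 - g)]. *)
Lemma ghost_recr (R : PsiObj) (a : nat -> R) n : (0 < n)%N ->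
  ghost g a n = n%:R * (1 - evalq g R) * a n +
    \sum_(d <- divisors n | d != n)
      (d%:R * (1 - evalq g R ^+ (n %/ d)) * pPsi (n %/ d) (a d)).
Proof.
move=> n0; rewrite /ghost (bigD1_seq n) ?divisors_id ?divisors_uniq //=.
by rewrite divnn n0 expr1 Psi1E.
Qed.

Lemma ghostD (R : PsiObj) (a b : nat -> R) n : (0 < n)%N ->
  ghost g (fun d => a d + b d) n = ghost g a n + ghost g b n.
Proof.
move=> n0; rewrite /ghost -big_split /= !big_seq; apply: eq_bigr => d.
rewrite -dvdn_divisors // => /(divn_dvd_gt0 n0) nd0.
by have [h ->] := Psi_rmorphism R nd0; rewrite rmorphD mulrDr.
Qed.

Lemma ghost0 (R : PsiObj) n : (0 < n)%N -> ghost g (fun _ => 0 : R) n = 0.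
Proof.
move=> n0; rewrite /ghost big_seq big1 // => d.
rewrite -dvdn_divisors // => /(divn_dvd_gt0 n0) nd0.
by have [h ->] := Psi_rmorphism R nd0; rewrite rmorph0 mulr0.
Qed.

Lemma ghost_nat (R S : PsiObj) (f : R -> S) (a : nat -> R) n : (0 < n)%N ->
  is_PsiMor f -> ghost g (fun d => f (a d)) n = f (ghost g a n).
Proof.
move=> n0 fm; have fg := PsiMor_evalq g fm; case: (fm) => _ _ _ _.
move: fg; have [h ->] := PsiMor_rmorphism fm => hg hPsi.
rewrite /ghost rmorph_sum /= !big_seq; apply: eq_bigr => d.
rewrite -dvdn_divisors // => /(divn_dvd_gt0 n0) nd0.
by rewrite !rmorphM rmorph_nat rmorphB rmorph1 rmorphXn /= hg hPsi.
Qed.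

Definition ghost_regular (R : PsiObj) := forall n (x : R), (0 < n)%N ->
  n%:R * (1 - evalq g R) * x = 0 -> x = 0.

(** Strong induction: the coordinates at proper divisors agree, so their terms cancel, and
    regularity cancels the coefficient of the remaining one. *)
Lemma ghost_inj (R : PsiObj) (a b : nat -> R) n : ghost_regular R ->
  (0 < n)%N -> (forall m, (m %| n)%N -> ghost g a m = ghost g b m) ->
  a n = b n.
Proof.
move=> reg; have [N leN] := ubnP n; elim: N n leN => // N IHN n leN n0 ab.
have := ab n (dvdnn n); rewrite !ghost_recr // => eq_ab.
apply/eqP; rewrite -subr_eq0; apply/eqP/(reg n) => //.
rewrite mulrBr; apply/eqP; rewrite subr_eq0; apply/eqP; move: eq_ab.
set s := \sum_(_ <- _ | _) _; set t := \sum_(_ <- _ | _) _.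
suff -> : s = t by apply: addIr.
rewrite /s /t big_seq_cond [RHS]big_seq_cond; apply: eq_bigr => d.
rewrite -dvdn_divisors // => /andP[dn neq]; rewrite (IHN d) //.
- by rewrite -ltnS (leq_trans _ leN) // ltnS ltn_neqAle neq dvdn_leq.
- exact: dvdn_gt0 dn.
- by move=> m md; apply/ab/(dvdn_trans md).
Qed.

End Ghost.

(** * The image of the ghost map over Z[q] *)

(** Dependent choice with memory: [P s c] says that [c] may follow the history [s], and a
    continuation is required only for histories that were themselves admissible at every stage. *)
Lemma recursive_choice (T : choiceType) (x0 : T) (P : seq T -> pred T) :
  (forall s, (forall k, (k < size s)%N -> P (take k s) (nth x0 s k)) ->
     exists c, P s c) ->
  {a : nat -> T | forall n, P (mkseq a n) (a n)}.
Proof.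
pose good s := forall k, (k < size s)%N -> P (take k s) (nth x0 s k).
move=> step; pose next (s : {s | good s}) := sigW (step _ (svalP s)).
have goodS s : good (rcons (sval s) (sval (next s))).
  move=> k; rewrite size_rcons ltnS leq_eqVlt nth_rcons => /predU1P[->|ltk].
    by rewrite ltnn eqxx -cats1 take_size_cat //; apply: (svalP (next s)).
  by rewrite ltk -cats1 takel_cat ?(ltnW ltk) //; apply: (svalP s).
have good0 : good [::] by [].
pose F n := iter n (fun s => exist good _ (goodS s)) (exist good _ good0).
exists (fun n => sval (next (F n))) => n.
suff -> : mkseq (fun n => sval (next (F n))) n = sval (F n).
  exact: (svalP (next (F n))).
by elim: n => // n IHn; rewrite mkseqS IHn.
Qed.

Section Dwork.
Variable g : {poly int}.
Local Notation ghostZ := (@ghost g ZQ).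

(* This characterizes the image of the ghost map over Z[q]. When p divides
   1 - g, the congruence does not control the p-divisibility of the quotient
   T n / (1 - g), whence the third condition. *)
Definition dwork (T : nat -> {poly int}) := forall n, (0 < n)%N ->
  [/\ divides (1 - g) (T n),
      forall p, prime p -> (p %| n)%N ->
        divides (p ^ logn p n)%:R (T n - (T (n %/ p)%N \Po 'X^p))
    & forall p, prime p -> divides p%:R (1 - g) ->
        divides ((p ^ logn p n)%:R * (1 - g)) (T n)].

Lemma dworkM T U : dwork T -> dwork U -> dwork (fun n => T n * U n).
Proof.
move=> hT hU n n0; have [Ta Tb Tc] := hT n n0; have [Ua Ub Uc] := hU n n0.
split; first exact: divides_mulr.
- by move=> p pp pn; rewrite comp_polyM; apply: dividesBM; auto.
- by move=> p pp pg; apply: divides_mulr; auto.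
Qed.

Lemma dwork_ghost (a : nat -> ZQ) : dwork (ghostZ a).
Proof.
move=> n n0; rewrite /ghost evalq_ZQ; split.
- apply: divides_sum => d _; apply/divides_mulr/divides_mull.
  by rewrite (sub1X g (n %/ d)%N); apply/divides_mulr/divides_refl.
- move=> p pp pn; set m := (n %/ p)%N; have p0 := prime_gt0 pp.
  have nE : n = (m * p)%N by rewrite divnK.
  have m0 : (0 < m)%N by apply: divn_dvd_gt0.
  have mn : (m %| n)%N by rewrite nE dvdn_mulr.
  (* Divisors of [n] that divide [n / p] pair with the terms of the Psi^p image; any other divisor
     carries the whole [p]-part of [n], so its term vanishes modulo that power. *)
  rewrite (bigID (fun d => d %| m)%N) /= big_divisors_dvd //.
  rewrite rmorph_sum /= addrAC -sumrB; apply: dividesD; last first.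
    rewrite big_seq_cond; apply: divides_sum => d.
    rewrite -dvdn_divisors // => /andP[dn ndm].
    apply/divides_mulr/divides_mulr/divides_nat.
    have [k nE'] := dvdnP dn.
    have npk : ~~ (p %| k)%N.
      apply: contra ndm => /dvdnP[l kE]; apply/dvdnP; exists l.
      by rewrite /m nE' kE mulnAC mulnK.
    have := pfactor_dvdnn p n; rewrite {2}nE' Gauss_dvdr //.
    by rewrite coprimeXl // prime_coprime.
  apply: divides_sum_seq => d; rewrite -dvdn_divisors // => dm.
  have d0 := dvdn_gt0 m0 dm; set j := (m %/ d)%N.
  have j0 : (0 < j)%N by apply: divn_dvd_gt0.
  have -> : (n %/ d)%N = (p * j)%N by rewrite nE (mulnC m) -muln_divA.
  have -> : (d%:R * (1 - g ^+ j) * (a d \Po 'X^j)) \Po 'X^p =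
      d%:R * (1 - (g \Po 'X^p) ^+ j) * (a d \Po 'X^(p * j)).
    rewrite !comp_polyM comp_polyB comp_polyXnX -polyC_natr !comp_polyC.
    by rewrite (rmorphXn (comp_poly 'X^p)).
  rewrite -mulrBl -mulrBr; apply: divides_mulr.
  (* The factor [d] supplies the first power; the second comes from raising the congruence between
     [g \Po 'X^p] and [g ^+ p] modulo [p] to the power [j]. *)
  have -> : (p ^ logn p n = p ^ logn p d * p ^ (logn p j).+1)%N.
    rewrite -expnD; congr (p ^ _)%N; rewrite nE -(divnK dm) -/j.
    rewrite !lognM ?muln_gt0 ?j0 // (lognE p p) pp p0 dvdnn divnn p0 logn1.
    by rewrite /=; lia.
  rewrite natrM; apply: divides_mul.
    by apply/divides_nat/pfactor_dvdnn.
  rewrite opprB addrC addrA subrK exprM.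
  by apply: divides_subX_logn => //; apply: frobenius_poly.
- move=> p pp pg; apply: divides_sum_seq => d; rewrite -dvdn_divisors // => dn.
  have nE := divnK dn; have j0 := divn_dvd_gt0 n0 dn.
  apply: divides_mulr.
  have -> : (p ^ logn p n = p ^ logn p d * p ^ logn p (n %/ d))%N.
    by rewrite -{1}nE lognM // ?(dvdn_gt0 n0) // expnD mulnC.
  rewrite natrM -mulrA; apply: divides_mul.
    by apply/divides_nat/pfactor_dvdnn.
  exact: divides_sub1X_logn.
Qed.

Hypothesis g_neq1 : g != 1.

Let g1_neq0 : 1 - g != 0. Proof. by rewrite subr_eq0 eq_sym. Qed.

Lemma ZQ_regular : ghost_regular g ZQ.
Proof.
move=> n x n0; rewrite evalq_ZQ => /eqP; rewrite !mulf_eq0 (negPf g1_neq0) orbF.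
by rewrite -polyC_natr polyC_eq0 pnatr_eq0 eqn0Ngt n0 => /eqP.
Qed.

(** The number [c] is the correction to the [n]-th coordinate of [b]. Both sequences satisfy
    [dwork], so the difference is [1 - g] times some [D], and it remains to show that the [p]-part
    of [n] divides [D] for every prime [p]. *)
Lemma dwork_step (T b : nat -> ZQ) n : (0 < n)%N -> dwork T ->
  (forall k, (0 < k < n)%N -> ghostZ b k = T k) ->
  exists c, T n - ghostZ b n = n%:R * (1 - g) * c.
Proof.
move=> n0 dT bT.
have [Ta Tb Tc] := dT n n0; have [Ga Gb Gc] := dwork_ghost b n0.
have [D DE] := dividesB Ta Ga.
suff /divides_nat_partwise-/(_ n0)[c cE] : forall p, prime p ->
    divides ((p ^ logn p n)%:R : {poly int}) D.
  by exists c; rewrite DE cE mulrCA mulrA.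
move=> p pp; have [pn|npn] := boolP (p %| n)%N; last first.
  by rewrite lognE (negPf npn) !andbF; exists D; rewrite mul1r.
(* If [p] divides [1 - g], the third condition gives the claim after cancelling [1 - g]. Otherwise
   the congruences apply, their Psi^p terms cancelling because [b] already fits [T] at [n / p], and
   Gauss's lemma removes [1 - g]. *)
have [pg|npg] := boolP (p%:Z %| zcontents (1 - g))%Z.
  have /divides_natP pg' := pg.
  have [z zE] := dividesB (Tc p pp pg') (Gc p pp pg').
  exists z; apply: (mulfI g1_neq0); rewrite -DE zE.
  by rewrite -mulrA mulrCA.
apply: (divides_cancel_prime (f := 1 - g)) => //.
  by move=> /divides_natP; apply/negP.
rewrite -DE.
have := dividesB (Tb p pp pn) (Gb p pp pn).
rewrite (bT (n %/ p)%N); last by rewrite divn_dvd_gt0 // ltn_Pdiv // prime_gt1.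
by rewrite opprB addrA subrK.
Qed.

Lemma dwork_ghost_image T : dwork T ->
  {a : nat -> ZQ | forall n, (0 < n)%N -> ghostZ a n = T n}.
Proof.
move=> dT.
(* The list [s] holds the coordinates of index below [size s], and [c] is the next one. Index 0 is
   left unconstrained. *)
pose P s c := (size s == 0%N) ||
  (ghostZ (nth 0 (rcons s c)) (size s) == T (size s)).
have [|a aP] := @recursive_choice {poly int} 0 P.
  move=> s sP; rewrite /P; have [->|] := eqVneq (size s) 0%N; first by exists 0.
  rewrite -lt0n => n0 /=.
  have [k /andP[k0 ltk]|c cE] := @dwork_step T (nth 0 s) _ n0 dT.
    have := sP k ltk; rewrite /P size_takel ?(ltnW ltk) // eqn0Ngt k0 /=.
    move/eqP <-; apply: (@eq_ghost g ZQ) => // d /(dvdn_leq k0) led.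
    by rewrite -take_nth // nth_take.
  exists c; apply/eqP; rewrite -[RHS](subrK (ghostZ (nth 0 s) (size s))) cE.
  (* Past its end [nth 0 s] takes the default value 0, so its leading term vanishes and [c] is the
     whole new coordinate. *)
  rewrite !ghost_recr // evalq_ZQ nth_rcons ltnn eqxx nth_default //.
  rewrite mulr0 add0r.
  congr (_ + _); rewrite big_seq_cond [RHS]big_seq_cond; apply: eq_bigr => d.
  rewrite -dvdn_divisors // => /andP[dn neq].
  by rewrite nth_rcons ltn_neqAle neq dvdn_leq.
exists a => n n0; have := aP n; rewrite /P size_mkseq eqn0Ngt n0 /= => /eqP <-.
apply: (@eq_ghost g ZQ) => // d /(dvdn_leq n0) led.
by rewrite -mkseqS nth_mkseq.
Qed.

Definition delta (d n : nat) : ZQ := (n == d)%:R.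

Lemma ghost_delta d n : (0 < n)%N ->
  ghostZ (delta d) n = if (d %| n)%N then d%:R * (1 - g ^+ (n %/ d)) else 0.
Proof.
move=> n0; rewrite /ghost evalq_ZQ; case: ifPn => [dn|ndn].
  rewrite (bigD1_seq d) ?divisors_uniq -?dvdn_divisors //= /delta eqxx.
  rewrite comp_polyC mulr1 big1 ?addr0 // => k /negPf ->.
  by rewrite mulr0n comp_poly0 mulr0.
rewrite big_seq big1 // => k; rewrite -dvdn_divisors // /delta => kn.
have [kd|_] := eqVneq k d; first by rewrite -kd kn in ndn.
by rewrite mulr0n [pPsi _ _]comp_poly0 mulr0.
Qed.

(* K d e is the product of delta d and delta e in the ring attached to Z[q]. *)
Lemma structure_constants : exists K : nat -> nat -> nat -> ZQ,
  (forall d e n, (0 < n)%N ->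
     ghostZ (K d e) n = ghostZ (delta d) n * ghostZ (delta e) n) /\
  (forall d e n, (0 < n)%N -> ~~ ((d %| n) && (e %| n))%N -> K d e n = 0).
Proof.
pose h d e := dworkM (dwork_ghost (delta d)) (dwork_ghost (delta e)).
exists (fun d e => sval (dwork_ghost_image (h d e))).
have KE d e := svalP (dwork_ghost_image (h d e)).
split=> // d e n n0 nde.
(* If [d] or [e] fails to divide [n], it divides no divisor [m] of [n], so one factor of each ghost
   component is zero. *)
apply: (ghost_inj (b := fun=> 0) ZQ_regular n0) => m mn.
have m0 := dvdn_gt0 n0 mn.
rewrite ghost0 // KE // !ghost_delta //.
have [dm|] := boolP (d %| m)%N; last by rewrite mul0r.
have [em|] := boolP (e %| m)%N; last by rewrite mulr0.
by rewrite (dvdn_trans dm mn) (dvdn_trans em mn) in nde.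
Qed.

End Dwork.

(** * The product *)

Section Product.
Variables (g : {poly int}) (K : nat -> nat -> nat -> ZQ).

Definition mul_seq (R : PsiObj) (a b : nat -> R) (n : nat) : R :=
  \sum_(d <- divisors n) \sum_(e <- divisors n)
     evalq (K d e n) R * (pPsi (n %/ d) (a d) * pPsi (n %/ e) (b e)).

Lemma mul_seq_nat (R S : PsiObj) (f : R -> S) (a b : nat -> R) n : (0 < n)%N ->
  is_PsiMor f ->
  f (mul_seq a b n) = mul_seq (fun d => f (a d)) (fun d => f (b d)) n.
Proof.
move=> n0 fm; have fev g := PsiMor_evalq g fm; case: (fm) => _ _ _ _.
move: fev; have [h ->] := PsiMor_rmorphism fm => hev hPsi.
rewrite rmorph_sum /=; apply: eq_big_seq => d; rewrite -dvdn_divisors // => dn.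
rewrite rmorph_sum /=; apply: eq_big_seq => e; rewrite -dvdn_divisors // => en.
by rewrite !rmorphM /= hev !hPsi ?divn_dvd_gt0.
Qed.

(** The coefficients of the ghost map are the ghost components of the [delta d], carried from Z[q]
    to [R]; in this form [ghostK] can be applied to a product. *)
Lemma ghost_sum_delta (R : PsiObj) (a : nat -> R) n : (0 < n)%N ->
  ghost g a n =
  \sum_(d <- divisors n) evalq (ghost g (delta d) n) R * pPsi (n %/ d) (a d).
Proof.
move=> n0; apply: eq_big_seq => d; rewrite -dvdn_divisors // => dn.
rewrite ghost_delta // dn.
have [h hE] := @PsiMor_rmorphism ZQ R _ (evalq_PsiMor R).
have {}hE f : evalq f R = h f by rewrite -hE.
by rewrite !hE rmorphM rmorph_nat rmorphB rmorph1 rmorphXn.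
Qed.

Hypothesis ghostK : forall d e n, (0 < n)%N ->
  ghost g (K d e) n = ghost g (delta d) n * ghost g (delta e) n.
Hypothesis K0 :
  forall d e n, (0 < n)%N -> ~~ ((d %| n) && (e %| n))%N -> K d e n = 0.

(** Applying Psi^(n/k) turns Psi^(k/d) into Psi^(n/d), so the factors from [a] and [b] no longer
    depend on [k]. The vanishing [K0] lets both sums run over all divisors of [n]. *)
Lemma Psi_mul_seq (R : PsiObj) (a b : nat -> R) k n :
  (0 < n)%N -> (k %| n)%N ->
  pPsi (n %/ k) (mul_seq a b k) =
  \sum_(d <- divisors n) \sum_(e <- divisors n)
     pPsi (n %/ k) (evalq (K d e k) R)
       * (pPsi (n %/ d) (a d) * pPsi (n %/ e) (b e)).
Proof.
move=> n0 kn; have k0 := dvdn_gt0 n0 kn; have nk0 := divn_dvd_gt0 n0 kn.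
have PsiE d (x : R) : (d %| k)%N ->
    pPsi (n %/ d) x = pPsi (n %/ k) (pPsi (k %/ d) x).
  move=> dk; rewrite PsiPsi ?divn_dvd_gt0 //; congr (pPsi _ x).
  by rewrite -{1}(divnK kn) -muln_divA.
pose G d e := evalq (K d e k) R * (pPsi (k %/ d) (a d) * pPsi (k %/ e) (b e)).
have -> : mul_seq a b k = \sum_(d <- divisors n | (d %| k)%N)
    \sum_(e <- divisors n | (e %| k)%N) G d e.
  rewrite big_divisors_dvd //; apply: eq_bigr => d _.
  by rewrite big_divisors_dvd.
have hE := PsiE; move: hE; rewrite /G.
have [h ->] := Psi_rmorphism R nk0 => hE.
rewrite rmorph_sum big_mkcond /=; apply: eq_bigr => d _; case: ifPn => dk.
  rewrite rmorph_sum big_mkcond /=; apply: eq_bigr => e _; case: ifPn => ek.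
    by rewrite !rmorphM !hE.
  by rewrite K0 ?(negPf ek) ?andbF // -polyC0 evalqC rmorph_int mul0r.
rewrite big1 // => e _.
by rewrite K0 ?(negPf dk) // -polyC0 evalqC rmorph_int mul0r.
Qed.

(** After exchanging sums, the inner sum over [k] for fixed [d] and [e] is the ghost component of
    [K d e] carried to [R], which [ghostK] factors. *)
Lemma ghostM (R : PsiObj) (a b : nat -> R) n : (0 < n)%N ->
  ghost g (mul_seq a b) n = ghost g a n * ghost g b n.
Proof.
move=> n0; rewrite (ghost_sum_delta a n0) (ghost_sum_delta b n0) big_distrlr /=.
transitivity (\sum_(k <- divisors n) \sum_(d <- divisors n)
    \sum_(e <- divisors n) k%:R * (1 - evalq g R ^+ (n %/ k))
       * pPsi (n %/ k) (evalq (K d e k) R)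
       * (pPsi (n %/ d) (a d) * pPsi (n %/ e) (b e))).
  apply: eq_big_seq => k; rewrite -dvdn_divisors // => kn.
  rewrite Psi_mul_seq // mulr_sumr; apply: eq_bigr => d _.
  by rewrite mulr_sumr; apply: eq_bigr => e _; apply: mulrA.
rewrite exchange_big /=; apply: eq_bigr => d _.
rewrite exchange_big /=; apply: eq_bigr => e _.
rewrite -mulr_suml -[X in X * _]/(ghost g (fun k => evalq (K d e k) R) n).
rewrite (ghost_nat g (K d e) n0 (evalq_PsiMor R)) ghostK // evalqM.
by rewrite mulrACA.
Qed.

End Product.

(** * A cover of R on which the ghost map is injective *)

Section LinearExtension.
Variables (M : choiceType) (V : zmodType) (h : M -> V).

Definition malg_lin (x : {malg int[M]}) : V := \sum_(k <- msupp x) h k *~ x@_k.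

Lemma malg_linEw (d : {fset M}) x : (msupp x `<=` d)%fset ->
  malg_lin x = \sum_(k <- d) h k *~ x@_k.
Proof.
by move=> le; rewrite [LHS](big_fset_incl _ le) => //= k _ /mcoeff_outdom ->.
Qed.

Lemma malg_lin_is_zmod_morphism : zmod_morphism malg_lin.
Proof.
move=> x y; pose d := (msupp x `|` msupp y)%fset.
rewrite (@malg_linEw d x) ?fsubsetUl // (@malg_linEw d y) ?fsubsetUr //.
rewrite (@malg_linEw d (x - y)) ?msuppB_le // -sumrB.
by apply: eq_bigr => k _; rewrite mcoeffB mulrzBr.
Qed.

HB.instance Definition _ :=
  GRing.isZmodMorphism.Build {malg int[M]} V malg_lin malg_lin_is_zmod_morphism.

Lemma malg_linU k : malg_lin << k >> = h k.
Proof. by rewrite (malg_linEw msuppU_le) big_seq_fset1 mcoeffUU. Qed.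

End LinearExtension.

Lemma malgU_mulrz (M : choiceType) (c : int) (k : M) :
  << c *g k >> = << k >> *~ c :> {malg int[M]}.
Proof. by rewrite -[c in LHS]intz (raddfMz (mkmalgU k)). Qed.

Lemma additive_malg_lin (M : choiceType) (V : zmodType)
    (f : {additive {malg int[M]} -> V}) x :
  f x = malg_lin (fun k => f << k >>) x.
Proof.
rewrite {1}[x]monalgE raddf_sum; apply: eq_bigr => k _.
by rewrite malgU_mulrz raddfMz.
Qed.

Lemma eq_additive_malg (M : choiceType) (V : zmodType)
    (f f' : {additive {malg int[M]} -> V}) :
  (forall k, f << k >> = f' << k >>) -> f =1 f'.
Proof.
move=> ff' x; rewrite additive_malg_lin [RHS]additive_malg_lin.
by apply: eq_bigr => k _; rewrite ff'.
Qed.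

Lemma malgUM (M : monomType) (k l : M) :
  << k >> * << l >> = << mmul k l >> :> {malg int[M]}.
Proof. by rewrite malgM_def fgmulUU mulr1. Qed.

Lemma malg_linM (M : monomType) (S : comPzRingType) (h : M -> S) :
  (forall k l, h (mmul k l) = h k * h l) ->
  {morph malg_lin h : x y / x * y}.
Proof.
move=> hM x y.
rewrite malgME raddf_sum mulr_suml; apply: eq_bigr => k _.
rewrite raddf_sum mulr_sumr; apply: eq_bigr => l _ /=.
rewrite malgU_mulrz raddfMz /= malg_linU hM.
by rewrite mulrzAl mulrzAr [x@_k * _]mulrC mulrzA.
Qed.

Section Cover.
Variable R : PsiObj.

(* (i, Some r) stands for the monomial q^i [r]; None is a formal unit, since
   monomType requires units to be trivial. *)
Definition monid : Type := (nat * option R)%type.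
HB.instance Definition _ := Choice.on monid.

Definition monid_mul (k l : monid) : monid :=
  ((k.1 + l.1)%N, match k.2, l.2 with
    | Some r, Some s => Some (r * s) | None, o => o | o, None => o end).

Fact monid_mulA : associative monid_mul.
Proof.
by move=> [i [r|]] [j [s|]] [k [t|]]; rewrite /monid_mul /= addnA ?mulrA.
Qed.

Fact monid_mulC : commutative monid_mul.
Proof. by move=> [i [r|]] [j [s|]]; rewrite /monid_mul /= addnC // mulrC. Qed.

Fact monid_mul1 : left_id (0%N, None) monid_mul.
Proof. by move=> [i [r|]]. Qed.

Fact monid_mulr1 : right_id (0%N, None) monid_mul.
Proof. by move=> k; rewrite monid_mulC monid_mul1. Qed.

Fact monid_unit k l : monid_mul k l = (0%N, None) ->
  k = (0%N, None) /\ l = (0%N, None).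
Proof. by move: k l => [[|i] [r|]] [[|j] [s|]]. Qed.

HB.instance Definition _ := Choice_isMonomialDef.Build monid
  monid_mulA monid_mul1 monid_mulr1 monid_unit.
HB.instance Definition _ := MonomialDef_isConomialDef.Build monid monid_mulC.

Definition cover : comNzRingType := {malg int[monid]}.

Definition cover_gen (i : nat) (o : option R) : cover := << (i, o) : monid >>.

Lemma cover_genM i j o o' : cover_gen i o * cover_gen j o' =
  let k := monid_mul (i, o) (j, o') in cover_gen k.1 k.2.
Proof. exact: malgUM. Qed.

Lemma cover_gen_q n : cover_gen n None = cover_gen 1 None ^+ n.
Proof. by elim: n => // n IHn; rewrite exprS -IHn cover_genM. Qed.

Definition cover_Psi n : cover -> cover :=
  malg_lin (fun k : monid => cover_gen (n * k.1) (omap (@pPsi R n) k.2)).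
HB.instance Definition _ n := GRing.isZmodMorphism.Build cover cover
  (cover_Psi n) (malg_lin_is_zmod_morphism _).

Lemma cover_PsiE n i o :
  cover_Psi n (cover_gen i o) = cover_gen (n * i) (omap (@pPsi R n) o).
Proof. exact: malg_linU. Qed.

Fact cover_subproof : @is_zqPsi cover (cover_gen 1 None) cover_Psi.
Proof.
split.
  move=> x.
  apply: (eq_additive_malg (f := cover_Psi 1) (f' := idfun)) => -[i o].
  rewrite /= -[<< _ >>]/(cover_gen i o) cover_PsiE mul1n.
  by case: o => //= r; rewrite Psi1E.
split; first by move=> n _ x y; apply: raddfD.
split.
  move=> n n0 x y; apply: malg_linM => -[i o] [j o'].
  rewrite cover_genM /= mulnDr.
  have [h ->] := Psi_rmorphism R n0.
  by case: o o' => [r|] [s|] //=; rewrite rmorphM.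
split; first by move=> n _; rewrite [LHS]malg_linU /= muln0.
split.
  move=> n m n0 m0 x.
  apply: (eq_additive_malg (f := cover_Psi n \o cover_Psi m)) => -[i o] /=.
  rewrite -[<< _ >>]/(cover_gen i o) !cover_PsiE mulnA; congr cover_gen.
  by case: o => //= r; rewrite PsiPsi.
by move=> n _; rewrite cover_PsiE muln1 /= cover_gen_q.
Qed.

Definition coverObj : PsiObj := Build_PsiObj cover_subproof.

(** Only a set-theoretic section of the projection, which suffices for lifting sequences entry by
    entry. *)
Definition cover_lift (r : R) : coverObj := cover_gen 0 (Some r).

Definition cover_proj : coverObj -> R :=
  malg_lin (fun k : monid => @pq R ^+ k.1 * odflt 1 k.2).
HB.instance Definition _ := GRing.isZmodMorphism.Build cover R
  cover_proj (malg_lin_is_zmod_morphism _).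

Lemma cover_projE i o : cover_proj (cover_gen i o) = @pq R ^+ i * odflt 1 o.
Proof. exact: malg_linU. Qed.

Lemma cover_liftK : cancel cover_lift cover_proj.
Proof. by move=> r; rewrite cover_projE mul1r. Qed.

Lemma cover_proj_PsiMor : is_PsiMor cover_proj.
Proof.
split.
- exact: raddfD.
- apply: malg_linM => -[i o] [j o'] /=; rewrite exprD mulrACA.
  by case: o o' => [r|] [s|] //=; rewrite ?mul1r ?mulr1.
- by rewrite [LHS]malg_linU mulr1.
- by rewrite cover_projE mulr1.
- move=> n n0; have hq := Psi_q R n0; have [h hE] := Psi_rmorphism R n0.
  rewrite hE in hq *.
  apply: (eq_additive_malg (f := cover_proj \o cover_Psi n)
    (f' := h \o cover_proj)).
  move=> [i o] /=; rewrite -[<< _ >>]/(cover_gen i o) cover_PsiE !cover_projE.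
  rewrite rmorphM rmorphXn /= hq -exprM; congr (_ * _).
  by case: o => [r|] /=; rewrite ?rmorph1 ?hE.
Qed.

Section Regular.
Variable o : option R.

(* The cover is a free Z[q]-module with basis indexed by o; this is the
   coordinate along o. *)
Definition cover_row : cover -> {poly int} :=
  malg_lin (fun k : monid => if k.2 == o then 'X^(k.1) else 0).
HB.instance Definition _ := GRing.isZmodMorphism.Build cover {poly int}
  cover_row (malg_lin_is_zmod_morphism _).

Lemma cover_rowE j o' :
  cover_row (cover_gen j o') = if o' == o then 'X^j else 0.
Proof. exact: malg_linU. Qed.

Lemma cover_row_coef x i : (cover_row x)`_i = x@_((i, o) : monid).
Proof.
apply: (eq_additive_malg (f := coefp i \o cover_row)
  (f' := mcoeff ((i, o) : monid))) => -[j o'].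
rewrite /= -[X in cover_row X]/(cover_gen j o') cover_rowE mcoeffU.
rewrite -[(j, o') == _]/((j == i) && (o' == o)).
by case: (o' == o); rewrite ?andbT ?andbF ?coef0 // coefXn eq_sym; case: eqP.
Qed.

Lemma cover_rowXM n (x : cover) :
  cover_row (@pq coverObj ^+ n * x) = 'X^n * cover_row x.
Proof.
rewrite -[@pq _]/(cover_gen 1 None) -cover_gen_q.
apply: (eq_additive_malg (f := cover_row \o (cover_gen n None \*o idfun))
  (f' := 'X^n \*o cover_row)) => -[j o'].
rewrite /= -[<< _ >>]/(cover_gen j o') cover_genM !cover_rowE /=.
by case: ifP; rewrite ?mulr0 // exprD.
Qed.

Lemma cover_row_evalq p (x : cover) :
  cover_row (evalq p coverObj * x) = p * cover_row x.
Proof.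
rewrite mulr_suml raddf_sum -[p in RHS]coefK poly_def mulr_suml.
apply: eq_bigr => i _ /=.
by rewrite -mulrA mulrzl raddfMz /= cover_rowXM -scalerAl -scaler_int intz.
Qed.

End Regular.

(** Each coordinate [cover_row o] is Z[q]-linear, so regularity descends to Z[q] one coordinate at a
    time, and the coordinates together determine [x]. *)
Lemma cover_regular g : g != 1 -> ghost_regular g coverObj.
Proof.
move=> g1 n x n0 nx0; apply/malgP => -[i o]; rewrite mcoeff0 -cover_row_coef.
suff -> : cover_row o x = 0 by rewrite coef0.
apply: (ZQ_regular g1 n0); rewrite evalq_ZQ.
have := congr1 (cover_row o) nx0; rewrite raddf0 => <-.
rewrite -!mulrA !mulr_natl raddfMn /= !mulrBl !mul1r raddfB /=.
by rewrite cover_row_evalq.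
Qed.

End Cover.

(** * The functor *)

Section Structure.
Variable g : {poly int}.
Hypothesis g_neq1 : g != 1.

(** Passes to indexing by [n] itself. The value at 0 repeats the one at 1, and no ghost component of
    positive index reads it. *)
Let idx (T : Type) (a : seqN T) : nat -> T := fun n => a n.-1.

Lemma ghostmapE (R : PsiObj) (a : seqN R) k :
  ghostmap g a k = ghost g (idx a) k.+1.
Proof. by []. Qed.

Lemma ghostmap_inj (R : PsiObj) (a b : seqN R) : ghost_regular g R ->
  ghostmap g a = ghostmap g b -> a = b.
Proof.
move=> reg ab; apply: functional_extensionality => k.
have : idx a k.+1 = idx b k.+1; last by [].
apply: (ghost_inj reg) => // -[|m]; first by rewrite dvd0n.
by rewrite -!ghostmapE ab.
Qed.

(** Reduces an identity between natural operations on [seqN R] to one on [seqN U], where ghost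
    components decide it. *)
Lemma seqN_cover (R : PsiObj) : exists (U : PsiObj) (p : U -> R),
  [/\ is_PsiMor p,
      forall a : seqN R, exists a' : seqN U, a = (fun k => p (a' k))
    & forall a b : seqN U, ghostmap g a = ghostmap g b -> a = b].
Proof.
exists (coverObj R), (@cover_proj R); split.
- exact: cover_proj_PsiMor.
- move=> a; exists (fun k => cover_lift (a k)).
  by apply: functional_extensionality => k; rewrite cover_liftK.
- by move=> a b; apply/ghostmap_inj/cover_regular.
Qed.

Lemma Bbar_op_unique
    (op op' : forall R : PsiObj, seqN R -> seqN R -> seqN R) :
  (forall (R S : PsiObj) (f : R -> S), is_PsiMor f -> forall a b,
     (fun k => f (op R a b k)) = op S (fun k => f (a k)) (fun k => f (b k))) ->
  (forall (R S : PsiObj) (f : R -> S), is_PsiMor f -> forall a b,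
     (fun k => f (op' R a b k)) =
     op' S (fun k => f (a k)) (fun k => f (b k))) ->
  (forall R a b, ghostmap g (op R a b) = ghostmap g (op' R a b)) ->
  forall R, op R = op' R.
Proof.
move=> nat_op nat_op' gh R; apply: functional_extensionality => a.
apply: functional_extensionality => b.
have [U [p [pm lift inj]]] := seqN_cover R.
have [a' ->] := lift a; have [b' ->] := lift b.
by rewrite -(nat_op _ _ _ pm) (inj _ _ (gh _ _ _)) (nat_op' _ _ _ pm).
Qed.

Variable K : nat -> nat -> nat -> ZQ.
Hypothesis ghostK : forall d e n, (0 < n)%N ->
  ghost g (K d e) n = ghost g (delta d) n * ghost g (delta e) n.
Hypothesis K0 :
  forall d e n, (0 < n)%N -> ~~ ((d %| n) && (e %| n))%N -> K d e n = 0.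

Definition seqN_mul (R : PsiObj) (a b : seqN R) : seqN R :=
  fun k => mul_seq K (idx a) (idx b) k.+1.

Definition BbarOps (R : PsiObj) : rngOps (seqN R) :=
  RngOps (fun a b k => a k + b k) (fun _ => 0) (fun a k => - a k)
         (@seqN_mul R).

Lemma seqN_mul_nat (R S : PsiObj) (f : R -> S) (a b : seqN R) : is_PsiMor f ->
  (fun k => f (seqN_mul a b k)) =
  seqN_mul (fun k => f (a k)) (fun k => f (b k)).
Proof.
by move=> fm; apply: functional_extensionality => k; apply: mul_seq_nat.
Qed.

Lemma ghostmapM (R : PsiObj) (a b : seqN R) :
  ghostmap g (seqN_mul a b) = (fun k => ghostmap g a k * ghostmap g b k).
Proof.
apply: functional_extensionality => k.
rewrite -(ghostM ghostK K0 (idx a) (idx b) (ltn0Sn k)).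
(* The two sequences agree at every positive index, and 0 does not divide [k.+1]. *)
by apply: eq_ghost => // -[].
Qed.

Lemma ghostmapD (R : PsiObj) (a b : seqN R) :
  ghostmap g (fun k => a k + b k) = (fun k => ghostmap g a k + ghostmap g b k).
Proof.
apply: functional_extensionality => k.
exact: (ghostD g (idx a) (idx b) (ltn0Sn k)).
Qed.

Lemma seqN_mulC (R : PsiObj) (a b : seqN R) : seqN_mul a b = seqN_mul b a.
Proof.
have [U [p [pm lift inj]]] := seqN_cover R.
have [a' ->] := lift a; have [b' ->] := lift b.
rewrite -!(seqN_mul_nat _ _ pm).
suff -> : seqN_mul a' b' = seqN_mul b' a' by [].
apply: inj; rewrite !ghostmapM.
by apply: functional_extensionality => k; apply: mulrC.
Qed.

Lemma seqN_mulA (R : PsiObj) (a b c : seqN R) :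
  seqN_mul a (seqN_mul b c) = seqN_mul (seqN_mul a b) c.
Proof.
have [U [p [pm lift inj]]] := seqN_cover R.
have [a' ->] := lift a; have [b' ->] := lift b; have [c' ->] := lift c.
rewrite -!(seqN_mul_nat _ _ pm).
suff -> : seqN_mul a' (seqN_mul b' c') = seqN_mul (seqN_mul a' b') c' by [].
apply: inj; rewrite !ghostmapM.
by apply: functional_extensionality => k; apply: mulrA.
Qed.

Lemma seqN_mulDl (R : PsiObj) (a b c : seqN R) :
  seqN_mul (fun k => a k + b k) c =
  (fun k => seqN_mul a c k + seqN_mul b c k).
Proof.
have [U [p [pm lift inj]]] := seqN_cover R.
have pD (u v : seqN U) :
    (fun k => p (u k) + p (v k)) = (fun k => p (u k + v k)).
  by case: pm => D _ _ _ _; apply: functional_extensionality => k; rewrite D.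
have [a' ->] := lift a; have [b' ->] := lift b; have [c' ->] := lift c.
rewrite pD -!(seqN_mul_nat _ _ pm) pD.
suff -> : seqN_mul (fun k => a' k + b' k) c' =
    (fun k => seqN_mul a' c' k + seqN_mul b' c' k) by [].
apply: inj; rewrite ghostmapM !ghostmapD !ghostmapM.
by apply: functional_extensionality => k; apply: mulrDl.
Qed.

Lemma BbarOps_is_Bbar : is_Bbar g BbarOps.
Proof.
split=> [R|R S f fm|R].
- do !split=> /=; try by move=> *; apply: functional_extensionality => k;
    rewrite ?addrA ?add0r ?addNr // addrC.
  + exact: seqN_mulA.
  + exact: seqN_mulC.
  + exact: seqN_mulDl.
- split=> a b /=; last exact: seqN_mul_nat.
  by case: fm => fD _ _ _ _; apply: functional_extensionality => k; rewrite fD.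
- by split=> a b; [apply: ghostmapD | apply: ghostmapM].
Qed.

End Structure.

Lemma is_Bbar1 : is_Bbar 1 (fun R => RngOps
  (fun (a b : seqN R) k => a k + b k) (fun _ => 0) (fun a k => - a k)
  (fun _ _ _ => 0)).
Proof.
have gh0 (R : PsiObj) (a : seqN R) : ghostmap 1 a = fun=> 0.
  apply: functional_extensionality => k; apply: big1_seq => d _.
  by rewrite -polyC1 evalqC mulr1z expr1n subrr mulr0 mul0r.
split=> [R|R S f fm|R].
- by do !split=> /=; move=> *; apply: functional_extensionality => k;
    rewrite ?addrA ?add0r ?addNr ?addr0 // addrC.
- have [h ->] := PsiMor_rmorphism fm.
  by split=> a b; apply: functional_extensionality => k;
    rewrite /= ?rmorphD ?rmorph0.
- by split=> a b /=; apply: functional_extensionality => k;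
    rewrite !gh0 ?addr0 ?mulr0.
Qed.

Theorem theorem5p3 (g : {poly int}) :
  (exists B : forall R : PsiObj, rngOps (seqN R), is_Bbar g B) /\
  (g != 1 ->
   forall B B' : forall R : PsiObj, rngOps (seqN R),
     is_Bbar g B -> is_Bbar g B' ->
     forall R : PsiObj,
       [/\ radd (B R) = radd (B' R), rzero (B R) = rzero (B' R),
           ropp (B R) = ropp (B' R) & rmul (B R) = rmul (B' R)]).
Proof.
split.
  have [->|g_neq1] := eqVneq g 1; first by eexists; apply: is_Bbar1.
  have [K [ghostK K0]] := structure_constants g_neq1.
  by exists (BbarOps K); apply: BbarOps_is_Bbar.
move=> g_neq1 B B' [BR Bf Bg] [BR' Bf' Bg'] R.
(* Addition is not prescribed by (1)-(3) directly, so it is compared through ghost components just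
   as the product is. *)
have eqD : radd (B R) = radd (B' R).
  apply: (Bbar_op_unique g_neq1 (op := fun R => radd (B R))
    (op' := fun R => radd (B' R))) => [S T f fm a b|S T f fm a b|S a b].
  - by have [-> _] := Bf _ _ _ fm.
  - by have [-> _] := Bf' _ _ _ fm.
  - by have [-> _] := Bg S; have [-> _] := Bg' S.
have eqM : rmul (B R) = rmul (B' R).
  apply: (Bbar_op_unique g_neq1 (op := fun R => rmul (B R))
    (op' := fun R => rmul (B' R))) => [S T f fm a b|S T f fm a b|S a b].
  - by have [_ ->] := Bf _ _ _ fm.
  - by have [_ ->] := Bf' _ _ _ fm.
  - by have [_ ->] := Bg S; have [_ ->] := Bg' S.
(* In an abelian group the addition determines zero and negation. *)
have [A [C [Z [N _]]]] := BR R; have [A' [C' [Z' [N' _]]]] := BR' R.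
have eq0 : rzero (B R) = rzero (B' R).
  by rewrite -[LHS]Z' -eqD C Z.
split=> //; apply: functional_extensionality => x.
rewrite -[RHS]Z -(N x) -A eqD [radd (B' R) x _]C' N' -eq0 -eqD.
by rewrite C Z.
Qed.
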